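(* Let $\Gamma$ be an infinite Abelian group which is not torsion-free, and let $T$ be a tree of diameter $5$ with central vertices $v_{c_1},v_{c_2}$ such that $v_{c_1}\in\Omega_{\mathfrak{s}}(T)\cup\Omega_{\mathfrak{w}}(T)$ and $v_{c_2}\notin\Omega_{\mathfrak{s}}(T)\cup\Omega_{\mathfrak{w}}(T)$. Then $T$ is $\Gamma$-vertex magic if and only if both of the following hold: (i) $v_{c_1}$ is not adjacent to any vertex of $\Omega_{\mathfrak{w}}(T)$; (ii) $\gcd(\deg(v_{c_2})-1,e(\Gamma))\neq 1$.
   Context: Graphs are finite, simple and undirected. For an additive Abelian group $\Gamma$ with identity $0$ and a graph $G$, a $\Gamma$-vertex magic labeling is a map $\ell:V(G)\to\Gamma\setminus\{0\}$ for which there is $\mu\in\Gamma$ with $w(v)=\sum_{u\in N(v)}\ell(u)=\mu$ for every vertex $v$; $G$ is $\Gamma$-vertex magic if it has such a labeling. A pendant vertex has degree $1$. $\Omega_{\mathfrak{s}}(T)$ is the set of strong support vertices (adjacent to at least two pendant vertices) and $\Omega_{\mathfrak{w}}(T)$ the set of weak support vertices (adjacent to exactly one pendant vertex). A tree of diameter $5$ has two adjacent central vertices $v_{c_1},v_{c_2}$, the two middle vertices of any longest path. A torsion-free group has only $0$ as element of finite order. The torsion elements $\Gamma_T$ form a subgroup; the exponent of a group is the least positive $n$ with $ng=0$ for all its elements ($\infty$ if none), and by the paper's convention, for $\Gamma$ not torsion-free, $e(\Gamma)$ denotes $e(\Gamma_T)$.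
   Formalization: When e(Γ) is infinite, gcd(n, e(Γ)), which is otherwise undefined, is read as the lcm of the divisors of n that divide the order of some torsion element of Γ; reading it as n or as 1 would make the claim false. *)

(* Defs.v *)
From HB Require Import structures.
From mathcomp Require Import all_boot all_algebra.
From mathcomp Require Import boolp classical_sets cardinality.

Set Implicit Arguments.
Unset Strict Implicit.
Unset Printing Implicit Defensive.

Import GRing.Theory.

Section Graphs.
Variables (V : finType) (e : rel V).

Definition neighbours (v : V) : {set V} := [set u | e v u].

Definition deg (v : V) : nat := #|neighbours v|.

Definition pendant (v : V) : bool := deg v == 1.

Definition strong_support : {set V} :=
  [set v | 2 <= #|[set u in neighbours v | pendant u]|].

Definition weak_support : {set V} :=
  [set v | #|[set u in neighbours v | pendant u]| == 1].

(* The bound on the size is needed because [:: x; y] is a ucycle whenever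
   x and y are adjacent. *)
Definition is_tree : Prop :=
  [/\ symmetric e, irreflexive e, 0 < #|V|,
      forall x y, connect e x y
    & forall c : seq V, ucycle e c -> size c <= 2].

(* Length of a shortest walk from x to y; the junk value #|V| is taken exactly
   when y is not reachable from x. *)
Definition dist (x y : V) : nat :=
  find (fun n => [exists p : n.-tuple V, path e x p && (last x p == y)])
       (iota 0 #|V|).

Definition diameter : nat := \max_(x : V) \max_(y : V) dist x y.

(* x :: p is the vertex sequence, so size p is the number of edges. *)
Definition simple_path (x : V) (p : seq V) : bool :=
  path e x p && uniq (x :: p).

Definition longest_path (x : V) (p : seq V) : Prop :=
  simple_path x p /\ forall y q, simple_path y q -> size q <= size p.

(* Meant for longest paths with an odd number 2k+1 of edges, whose two middle
   vertices have indices k and k+1; the pair is unordered. *)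
Definition central_vertices (c1 c2 : V) : Prop :=
  forall x p, longest_path x p ->
    [set nth x (x :: p) (size p)./2; nth x (x :: p) (size p)./2.+1]
    = [set c1; c2].

End Graphs.

Section Groups.
Variable G : zmodType.
Local Open Scope ring_scope.
Local Open Scope classical_set_scope.

Definition torsion : set G := [set g | exists n, (0 < n)%N /\ g *+ n = 0].

Definition torsion_free : Prop := forall g, torsion g -> g = 0.

Definition annihilates (A : set G) (n : nat) : bool :=
  (0 < n)%N && `[< forall g, A g -> g *+ n = 0 >].

(* None stands for the exponent oo. *)
Definition exponent (A : set G) : option nat :=
  if pselect (exists n, annihilates A n) is left ex
  then Some (ex_minn ex) else None.

(* The order of g is the exponent of [set g]. *)
Definition divides_some_order (d : nat) : Prop :=
  exists g m, exponent [set g] = Some m /\ (d %| m)%N.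

(* gcd(n, e(G)), where e(G) is the exponent of the torsion subgroup of G.
   When this exponent is oo, it is read as the supernatural number
   lcm {order of g | g torsion}, so that gcd(n, oo) is the lcm of the divisors
   of n that divide the order of some torsion element.  The symbol oo alone
   does not determine which primes divide an order: Z(2^oo) and Q/Z both have
   exponent oo, but only the second has 3-torsion. *)
Definition gcd_exponent (n : nat) : nat :=
  if exponent torsion is Some m then gcdn n m
  else \big[lcmn/1%N]_(d <- divisors n | `[< divides_some_order d >]) d.

End Groups.

Definition vertex_magic (G : zmodType) (V : finType) (e : rel V) : Prop :=
  exists l : V -> G, (forall v, l v <> 0%R) /\
  exists mu : G, forall v, (\sum_(u in neighbours e v) l u)%R = mu.

(* Main.v *)
Require Import Defs.
From mathcomp Require Import all_boot all_algebra.
From mathcomp Require Import boolp classical_sets cardinality.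

(** In a magic labeling every vertex with a pendant neighbour is labeled [mu],
    the weight of that neighbour.  A walk without backtracking in a tree is a
    simple path, so prolonging a path with 5 edges through its middle shows that
    every vertex other than [c2] that is not pendant has a pendant neighbour.
    Hence the weight of [c2] is [deg c2 * mu], which forces
    [(deg c2 - 1) * mu = 0] with [mu <> 0].  A weak support vertex adjacent to
    [c1] has weight [mu] plus the label of its pendant neighbour, which would
    then vanish.  Conversely, given such a [mu], put [mu] on every vertex that is
    neither pendant nor [c2] and a generic [y] on [c2]; the equation at a support
    vertex only involves its own pendant neighbours, and it is solvable except
    when there is a single one and its label is forced to be [0].  As weak support
    vertices are adjacent to [c2] and not to [c1], a generic [y] excludes this. *)

Set Implicit Arguments.
Unset Strict Implicit.
Unset Printing Implicit Defensive.

Import GRing.Theory.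

Section Exponents.
Variable G : zmodType.
Local Open Scope ring_scope.

Lemma exponent_SomeP (A : set G) m : exponent A = Some m ->
  annihilates A m /\ forall k, annihilates A k -> (m <= k)%N.
Proof.
rewrite /exponent; case: pselect => // exn [<-].
by case: ex_minnP => k Ak mink.
Qed.

Lemma annihilates_exponent (A : set G) n :
  annihilates A n -> exists m, exponent A = Some m.
Proof.
move=> An; rewrite /exponent; case: pselect => [ex|[]]; last by exists n.
by exists (ex_minn ex).
Qed.

Lemma exponent_prime_factor (A : set G) m p :
  exponent A = Some m -> prime p -> (p %| m)%N ->
  exists mu : G, mu <> 0 /\ mu *+ p = 0.
Proof.
move=> /exponent_SomeP[/andP[m_gt0 /asboolP Am] minm] p_pr /dvdnP[k def_m].
have k_gt0 : (0 < k)%N by move: m_gt0; rewrite def_m muln_gt0 => /andP[].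
have /existsNP[g /not_implyP[Ag gk]] : ~ forall g, A g -> g *+ k = 0.
  move=> Ak; have /minm : annihilates A k by rewrite /annihilates k_gt0; apply/asboolP.
  by rewrite def_m leqNgt ltn_Pmulr ?prime_gt1.
by exists (g *+ k); split=> //; rewrite -mulrnA -def_m Am.
Qed.

Lemma mulrn_coprime_eq0 (mu : G) m n : (0 < n)%N -> coprime n m ->
  mu *+ n = 0 -> mu *+ m = 0 -> mu = 0.
Proof.
move=> n_gt0 /eqP cop mun mum.
case: (egcdnP m n_gt0) => km kn; rewrite cop => eqk _.
have := congr1 (fun k => mu *+ k) eqk.
by rewrite mulnC mulrnA mun mul0rn mulrnDr mulnC mulrnA mum mul0rn add0r mulr1n.
Qed.

Lemma gcd_exponent_neq1P n : (0 < n)%N ->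
  gcd_exponent G n <> 1%N <-> exists mu : G, mu <> 0 /\ mu *+ n = 0.
Proof.
have from_prime p (A : set G) m : prime p -> (p %| n)%N -> (p %| m)%N ->
    exponent A = Some m -> exists mu : G, mu <> 0 /\ mu *+ n = 0.
  move=> p_pr /dvdnP[k ->] pm /exponent_prime_factor/(_ p_pr pm)[mu [mu0 mup]].
  by exists mu; split=> //; rewrite mulnC mulrnA mup mul0rn.
move=> n_gt0; rewrite /gcd_exponent; case expT: exponent => [m|]; split.
- move=> gcd1.
  have /from_prime : prime (pdiv (gcdn n m)).
    by rewrite pdiv_prime // ltn_neqAle eq_sym gcdn_gt0 n_gt0 andbT; apply/eqP.
  apply; last exact: expT.
    exact: dvdn_trans (pdiv_dvd _) (dvdn_gcdl _ _).
  exact: dvdn_trans (pdiv_dvd _) (dvdn_gcdr _ _).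
- move=> [mu [mu0 mun]] cop; apply: mu0.
  have [/andP[_ /asboolP Am] _] := exponent_SomeP expT.
  apply: (mulrn_coprime_eq0 n_gt0 _ mun (Am _ _)); first exact/eqP.
  by exists n.
- move=> lcm1.
  have [d [dn d1 [g [m [expg dm]]]]] :
      exists d, [/\ (d %| n)%N, d <> 1%N & divides_some_order G d].
    apply: contra_notP lcm1 => noex; apply: big1_seq => d.
    rewrite -dvdn_divisors // => /andP[/asboolP ordd dn].
    by apply: contra_notP noex => d1; exists d.
  have d_gt0 := dvdn_gt0 n_gt0 dn.
  apply: (from_prime (pdiv d) _ m _ _ _ expg).
  + by rewrite pdiv_prime // ltn_neqAle eq_sym d_gt0 andbT; apply/eqP.
  + exact: dvdn_trans (pdiv_dvd _) dn.
  + exact: dvdn_trans (pdiv_dvd _) dm.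
- move=> [mu [mu0 mun]] lcm1.
  have annP k : annihilates [set mu]%classic k <-> (0 < k)%N /\ mu *+ k = 0.
    split; first by case/andP => k_gt0 /asboolP Ak; split=> //; apply: Ak.
    by case=> k_gt0 muk; rewrite /annihilates k_gt0; apply/asboolP => _ ->.
  have [m expmu] : exists m, exponent [set mu]%classic = Some m.
    by apply: (@annihilates_exponent _ n); apply/annP.
  have [/annP[m_gt0 mum] minm] := exponent_SomeP expmu.
  have mn : (m %| n)%N.
    rewrite /dvdn -leqn0 leqNgt; apply/negP => r_gt0.
    have /minm : annihilates [set mu]%classic (n %% m)%N.
      apply/annP; split=> //; move: mun.
      by rewrite {1}(divn_eq n m) mulrnDr mulnC mulrnA mum mul0rn add0r.
    by rewrite leqNgt ltn_mod m_gt0.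
  have : (m %| 1)%N.
    rewrite -lcm1 (big_rem m) /=; last by rewrite -dvdn_divisors.
    have -> : `[< divides_some_order G m >].
      by apply/asboolP; exists mu, m.
    exact: dvdn_lcml.
  by rewrite dvdn1 => /eqP m1; apply: mu0; rewrite -mum m1 mulr1n.
Qed.

Lemma infinite_avoid (s : seq G) :
  infinite_set [set: G]%classic -> exists y : G, y \notin s.
Proof.
move=> Ginf; apply: contra_notP Ginf => allin.
have -> : [set: G]%classic = [set` s]%classic.
  apply/seteqP; split=> x //= _; apply: contra_notT allin => xs.
  by exists x.
exact: finite_seq.
Qed.

Lemma nonzero_labels_sum (T : finType) (A : {set T}) (t : G) :
    infinite_set [set: G]%classic -> A != finset.set0 -> (#|A| = 1%N -> t <> 0) ->
  exists f : T -> G, (forall x, f x <> 0) /\ \sum_(x in A) f x = t.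
Proof.
move=> Ginf /set0Pn[a aA] A1.
have [g g0] := infinite_avoid [:: 0] Ginf.
have {}g0 : g <> 0 by move: g0; rewrite mem_seq1 => /eqP.
have [B0|/set0Pn[b]] := eqVneq (A :\ a)%SET finset.set0.
  have t0 : t <> 0 by apply: A1; rewrite (cardsD1 a) aA B0 cards0.
  exists (fun=> t); split=> //.
  by rewrite (big_setD1 a) //= B0 big_set0 addr0.
move=> bB; set r : G := \sum_(x in A :\ a :\ b) g.
have [h] := infinite_avoid [:: 0; t - r] Ginf.
rewrite !inE negb_or => /andP[/eqP h0 /eqP htr].
have ba : b != a by move: bB; rewrite !inE => /andP[].
exists (fun x => if x == a then h else if x == b then t - r - h else g); split.
  move=> x; case: ifP => // _; case: ifP => // _ /eqP.
  by rewrite subr_eq0 => /eqP/esym.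
rewrite (big_setD1 a) //= eqxx (big_setD1 b) //= (negbTE ba) eqxx.
rewrite (eq_bigr (fun=> g)); last first.
  by move=> x; rewrite !inE => /and3P[/negbTE-> /negbTE->].
by rewrite -/r addrA [h + _]addrC subrK subrK.
Qed.

End Exponents.

Section Trees.
Variables (V : finType) (e : rel V).
Hypothesis T_tree : is_tree e.

Let e_sym : symmetric e. Proof. by case: T_tree. Qed.
Let e_irr : irreflexive e. Proof. by case: T_tree. Qed.

Lemma adj_neq x y : e x y -> x != y.
Proof. by apply: contraTneq => ->; rewrite e_irr. Qed.

Lemma tree_no_detour x a r : path e a r -> x \notin a :: r ->
  e x a -> e x (last a r) -> last a r = a.
Proof.
move=> pr xr xa xb; case: T_tree => _ _ _ _ acyc.
case/shortenP: pr xb => q pq uq sq xb.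
have xq : x \notin a :: q.
  apply: contra xr; rewrite !inE => /orP[->//|/sq ->]; exact: orbT.
have /acyc : ucycle e (x :: a :: q).
  by apply/andP; split; [rewrite /= rcons_path xa pq e_sym | rewrite cons_uniq xq].
by case: q {pq uq sq xb xq}.
Qed.

Lemma tree_path_unique x p q : simple_path e x p -> simple_path e x q ->
  last x p = last x q -> p = q.
Proof.
elim: p x q => [|a p IHp] x [|b q] //=.
- move=> _ /andP[_ /andP[xq _]] lx; case/negP: xq.
  by rewrite lx /= mem_last.
- move=> /andP[_ /andP[xp _]] _ lx; case/negP: xp.
  by rewrite -lx /= mem_last.
move=> /andP[/= /andP[xa pa] /and3P[xp ap up]].
move=> /andP[/= /andP[xb pb] /and3P[xq bq uq]] lpq.
have ab : a = b.
  have pr : path e a (p ++ rev (belast b q)).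
    rewrite cat_path pa lpq rev_path.
    by rewrite (eq_path (e' := e)) // => u v; rewrite e_sym.
  have lr : last a (p ++ rev (belast b q)) = b.
    by rewrite last_cat; case: (q) lpq => //= c q' _; rewrite rev_cons last_rcons.
  rewrite -lr; apply/esym; apply: (tree_no_detour (x := x)) => //; last by rewrite lr.
  rewrite -cat_cons mem_cat negb_or xp mem_rev.
  by apply: contra xq => /mem_belast.
rewrite -{b}ab in xb pb xq bq lpq *; congr (_ :: _).
by apply: (IHp a) => //; rewrite /simple_path /= ?pa ?pb ?ap ?bq.
Qed.

Lemma dist_simple_path x p : simple_path e x p -> dist e x (last x p) = size p.
Proof.
move=> sp; have /andP[pp up] := sp.
have szp : size p < #|V| by have := max_card (mem (x :: p)); rewrite (card_uniqP up).
rewrite /dist; set P := fun n => _.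
have Pp : P (size p) by apply/existsP; exists (in_tuple p); rewrite /= pp eqxx.
have hasP : has P (iota 0 #|V|) by apply/hasP; exists (size p); rewrite ?mem_iota.
apply/eqP; rewrite eqn_leq; apply/andP; split.
  rewrite leqNgt; apply/negP => /(before_find 0).
  by rewrite nth_iota // add0n Pp.
have := nth_find 0 hasP; rewrite nth_iota; last by rewrite -[X in _ < X](size_iota 0) -has_find.
set k := find _ _; case/existsP => -[q /= /eqP szq] /andP[pq /eqP lq].
rewrite add0n in szq; rewrite -szq.
case/shortenP: pq lq => r pr ur sr lr.
rewrite (@tree_path_unique x p r) //; last exact/andP.
apply: uniq_leq_size sr.
by case/andP: ur.
Qed.

Lemma connect_simple_path x y : exists2 p, simple_path e x p & last x p = y.
Proof.
case: T_tree => _ _ _ conn _; have /connectP[p pp ->] := conn x y.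
by case/shortenP: pp => q pq uq _; exists q => //; apply/andP.
Qed.

Lemma simple_path_size x p : simple_path e x p -> size p <= diameter e.
Proof.
move=> sp; rewrite -(dist_simple_path sp) /diameter.
by apply: leq_trans (leq_bigmax x); apply: leq_bigmax.
Qed.

Lemma diameter_path : exists x p, simple_path e x p /\ size p = diameter e.
Proof.
have V_gt0 : 0 < #|V| by case: T_tree.
have [x def_x] := eq_bigmax (fun x => \max_y dist e x y) V_gt0.
have [y def_y] := eq_bigmax (dist e x) V_gt0.
have [p sp lp] := connect_simple_path x y.
by exists x, p; split=> //; rewrite -(dist_simple_path sp) lp /diameter def_x def_y.
Qed.

Fixpoint nonbacktracking (s : seq V) : bool :=
  if s is x :: s' then
    (if s' is _ :: z :: _ then x != z else true) && nonbacktracking s'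
  else true.

Lemma nonbacktracking_simple x p :
  path e x p -> nonbacktracking (x :: p) -> simple_path e x p.
Proof.
move=> pp nb; apply/andP; split=> //.
elim: p x pp nb => // a p IHp x; rewrite [path _ _ _]/= => /andP[xa pa] /andP[nbx nba].
have ua := IHp a pa nba.
rewrite cons_uniq ua andbT in_cons negb_or adj_neq //=.
apply/negP => xp; case/splitPr: p / xp pa nbx ua {IHp nba} => p1 p2.
rewrite cat_path /= => /and3P[p1a lx _] nbx ua.
have : last a p1 = a.
  apply: (tree_no_detour (x := x)) => //; last by rewrite e_sym.
  have /= := cat_uniq (a :: p1) (x :: p2); rewrite ua => /esym/and3P[_ + _].
  by rewrite negb_or => /andP[].
case: p1 p1a lx nbx ua => [|b p1] /=; first by rewrite eqxx.
by move=> _ _ _ /andP[+ _] la; rewrite -cat_cons mem_cat -{1}la mem_last.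
Qed.

Lemma pendant_neighbours u v : pendant e u -> e u v ->
  neighbours e u = [set v]%SET.
Proof.
move=> /cards1P[w def_w] uv; have : v \in neighbours e u by rewrite inE.
by rewrite def_w finset.in_set1 => /eqP->.
Qed.

Lemma pendant_unique u v w : pendant e u -> e u v -> e u w -> w = v.
Proof.
by move=> pu /(pendant_neighbours pu) Nu uw; apply/set1P; rewrite -Nu inE.
Qed.

Lemma deg_ge2 u v w : e u v -> e u w -> v != w -> 1 < deg e u.
Proof.
move=> uv uw vw; apply: leq_trans (_ : #|[set v; w]%SET| <= _).
  by rewrite cards2 vw.
by apply/subset_leq_card/fintype.subsetP => z; rewrite !inE => /orP[]/eqP->.
Qed.

Lemma nonpendant u v w : e u v -> e u w -> v != w -> ~~ pendant e u.
Proof.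
by move=> uv uw vw; rewrite /pendant gtn_eqF // (deg_ge2 uv uw).
Qed.

Lemma nonpendant_other u v : e u v -> ~~ pendant e u ->
  exists2 w, e u w & w != v.
Proof.
move=> uv np; have : #|neighbours e u :\ v| != 0.
  by move: np; rewrite /pendant /deg (cardsD1 v) inE uv eqSS.
rewrite cards_eq0 => /set0Pn[w]; rewrite !inE => /andP[wv uw].
by exists w.
Qed.

Lemma supportP v : v \in strong_support e :|: weak_support e <->
  exists2 u, e v u & pendant e u.
Proof.
rewrite !inE eq_sym orbC -leq_eqVlt card_gt0; split.
  by case/set0Pn => u; rewrite !inE => /andP[]; exists u.
by case=> u vu pu; apply/set0Pn; exists u; rewrite !inE vu.
Qed.

Definition spine (c1 c2 : V) : Prop :=
  exists x0 x1 x4 x5, simple_path e x0 [:: x1; c1; c2; x4; x5].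

Lemma spine_sym c1 c2 : spine c1 c2 -> spine c2 c1.
Proof.
move=> [x0 [x1 [x4 [x5]]]] /andP[pp up]; exists x5, x4, x1, x0; apply/andP; split.
  move: pp => /= /and5P[e01 e1c1 ec12 ec2 /andP[e45 _]].
  by rewrite [e x5 x4]e_sym e45 [e x4 c2]e_sym ec2 [e c2 c1]e_sym ec12
    [e c1 x1]e_sym e1c1 [e x1 x0]e_sym e01.
by rewrite -[X in uniq X]/(rev [:: x0; x1; c1; c2; x4; x5]) rev_uniq.
Qed.

Lemma diameter5_spine c1 c2 :
  diameter e = 5 -> central_vertices e c1 c2 -> spine c1 c2.
Proof.
move=> diam central; have [x [p [sp szp]]] := diameter_path.
have lp : longest_path e x p.
  by split=> // y q /simple_path_size; rewrite szp.
have {central} := central x p lp; rewrite diam in szp.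
case: p szp sp {lp} => [|x1 [|x2 [|x3 [|x4 [|x5 []]]]]] //= _ sp cE.
have sp23 : spine x2 x3 by exists x, x1, x4, x5.
have x23 : x2 != x3.
  by case/and3P: sp => _ _ /and3P[_ + _]; rewrite inE negb_or => /andP[].
have : x2 \in [set c1; c2]%SET by rewrite -cE set21.
have : x3 \in [set c1; c2]%SET by rewrite -cE set22.
rewrite !inE => /orP[]/eqP x3E /orP[]/eqP x2E; move: sp23 x23;
  rewrite x2E x3E ?eqxx //.
by move=> /spine_sym.
Qed.

Lemma spine_adj c1 c2 : spine c1 c2 -> e c1 c2.
Proof. by move=> [x0 [x1 [x4 [x5]]]] /andP[/= /and5P[]]. Qed.

Lemma spine_nonpendant c1 c2 : spine c1 c2 -> ~~ pendant e c1.
Proof.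
move=> [x0 [x1 [x4 [x5]]]] /andP[/= /and5P[_ x1c1 c12 _ _] /and3P[_ + _]].
rewrite !inE !negb_or => /and4P[_ x1c2 _ _].
by apply: (nonpendant _ c12 x1c2); rewrite e_sym.
Qed.

Hypothesis T_diameter : diameter e = 5.

Lemma spine_pendant c1 c2 v w : spine c1 c2 ->
  e c1 v -> v != c2 -> e v w -> w != c1 -> pendant e w.
Proof.
move=> [x0 [x1 [x4 [x5]]]] /andP[/= /and5P[_ _ c12 c2x4 /andP[x45 _]]].
move=> /and4P[_ _ nc1 /andP[nc2 _]] c1v vc2 vw wc1.
apply: contraT => np.
have [z wz zv] := nonpendant_other (etrans (e_sym w v) vw) np.
have c1x4 : c1 != x4 by move: nc1; rewrite !inE !negb_or => /and3P[].
have c2x5 : c2 != x5 by move: nc2; rewrite !inE !negb_or => /andP[].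
have /simple_path_size : simple_path e z [:: w; v; c1; c2; x4; x5].
  apply: nonbacktracking_simple => /=.
    by rewrite (e_sym z) wz (e_sym w) vw (e_sym v) c1v c12 c2x4 x45.
  by rewrite zv wc1 vc2 c1x4 c2x5.
by rewrite T_diameter.
Qed.

Lemma spine_half_cover c1 c2 p : spine c1 c2 ->
    simple_path e c1 p -> head c1 p != c2 ->
  [\/ last c1 p = c1, e c1 (last c1 p)
    | exists a, [/\ e c1 a, a != c2, e a (last c1 p) & last c1 p != c1]].
Proof.
move=> sp; case: p => [|a [|w [|z p]]] /=.
- by constructor 1.
- by move=> /andP[/= /andP[c1a _] _] ac2; constructor 2.
- move=> /andP[/= /and3P[c1a aw _] /and3P[+ _ _]] ac2.
  rewrite !inE negb_or eq_sym [c1 == w]eq_sym => /andP[_ wc1].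
  by constructor 3; exists a.
move=> /andP[/= /and4P[c1a aw wz _] /and3P[nc1 na _]] ac2.
have wc1 : w != c1 by move: nc1; rewrite !inE !negb_or eq_sym [c1 == w]eq_sym => /and3P[].
have pw := spine_pendant sp c1a ac2 aw wc1.
have za : z = a by apply: (pendant_unique pw _ wz); rewrite e_sym.
by move: na; rewrite za !inE eqxx orbT.
Qed.

Lemma spine_cover c1 c2 v : spine c1 c2 ->
  [\/ v = c1, v = c2, e c1 v \/ e c2 v
    | exists a, [/\ e v a, ~~ pendant e a & pendant e v]].
Proof.
move=> sp; have sp' := spine_sym sp.
have far d1 d2 a : spine d1 d2 -> e d1 a -> a != d2 -> e a v -> v != d1 ->
    exists a, [/\ e v a, ~~ pendant e a & pendant e v].
  move=> sd d1a ad2 av vd1; exists a.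
  split; [by rewrite e_sym | | exact: spine_pendant sd d1a ad2 av vd1].
  by apply: (nonpendant _ av (v := d1)); rewrite 1?e_sym // eq_sym.
have [p s_p def_v] := connect_simple_path c1 v.
have [hp|hp] := eqVneq (head c1 p) c2; last first.
  have := spine_half_cover sp s_p hp; rewrite def_v => -[->|c1v|[a [? ? ? ?]]].
  - by constructor 1.
  - by constructor 3; left.
  - by constructor 4; apply: (far c1 c2 a).
case: p hp s_p def_v => [|a q] /=.
  by move=> c12; have := adj_neq (spine_adj sp); rewrite c12 eqxx.
move=> -> /andP[/= /andP[_ pq] /andP[c1q uq]] def_v.
have sq : simple_path e c2 q by apply/andP.
have hq : head c2 q != c1.
  apply: contra c1q => /eqP <-; case: (q) => [|b r] /=; first exact: mem_head.
  by rewrite !inE eqxx orbT.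
have := spine_half_cover sp' sq hq; rewrite def_v => -[->|c1v|[a' [? ? ? ?]]].
- by constructor 2.
- by constructor 3; right.
- by constructor 4; apply: (far c2 c1 a').
Qed.

Lemma spine_pendant_neighbour c1 c2 u v : spine c1 c2 ->
  pendant e u -> e u v -> ~~ pendant e v.
Proof.
move=> sp pu uv; have np1 := spine_nonpendant sp.
have np2 := spine_nonpendant (spine_sym sp).
have [uE|uE|[c1u|c2u]|[a [ua npa _]]] := spine_cover u sp.
- by rewrite uE (negbTE np1) in pu.
- by rewrite uE (negbTE np2) in pu.
- by rewrite (pendant_unique pu (v := c1) _ uv) // e_sym.
- by rewrite (pendant_unique pu (v := c2) _ uv) // e_sym.
- by rewrite (pendant_unique pu ua uv).
Qed.

End Trees.

Section Labelings.
Variables (G : zmodType) (V : finType) (e : rel V).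
Hypothesis e_sym : symmetric e.
Local Open Scope ring_scope.

Lemma magic_support (l : V -> G) mu u v :
    (forall v, \sum_(u in neighbours e v) l u = mu) ->
  pendant e u -> e u v -> l v = mu.
Proof.
by move=> lmu pu /(pendant_neighbours pu) Nu; rewrite -(lmu u) Nu big_set1.
Qed.

Lemma pendant_labels (t : V -> G) : infinite_set [set: G]%classic ->
    (forall v, v \in weak_support e -> t v <> 0) ->
  exists f : V -> G, (forall u, f u <> 0) /\
    forall v, v \in strong_support e :|: weak_support e ->
      \sum_(u in neighbours e v | pendant e u) f u = t v.
Proof.
move=> Ginf tw.
have /choice[F FP] v : exists f : V -> G, (forall u, f u <> 0) /\
    (v \in strong_support e :|: weak_support e ->
     \sum_(u in [set u in neighbours e v | pendant e u]%SET) f u = t v).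
  have [g] := infinite_avoid [:: 0] Ginf; rewrite mem_seq1 => /eqP g0.
  have [sv|nsv] := boolP (v \in _); last by exists (fun=> g).
  have [||f [f0 fs]] := @nonzero_labels_sum G V
      [set u in neighbours e v | pendant e u]%SET (t v) Ginf.
  - move/supportP: sv => [u vu pu].
    by apply/set0Pn; exists u; rewrite !inE vu.
  - by move/eqP => v1; apply: tw; rewrite inE.
  - by exists f; split.
exists (fun u => F (odflt u [pick v | e u v]) u); split=> [u|v sv].
  by have [] := FP (odflt u [pick v | e u v]).
have [_ <- //] := FP v; rewrite big_mkcondr /= [RHS]big_mkcond /= big_mkcond /=.
apply: eq_bigr => u _; rewrite !inE; case vu: (e v u) => //=.
case: ifP => // pu; have uv : e u v by rewrite e_sym.
case: pickP => [w /= uw|/(_ v)]; last by rewrite uv.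
by rewrite (pendant_unique pu uv uw).
Qed.

End Labelings.

Theorem theorem4p7 (G : zmodType)
    (G_infinite : infinite_set [set: G]%classic)
    (G_not_torsion_free : ~ torsion_free G)
    (V : finType) (e : rel V) (T_tree : is_tree e)
    (T_diameter : diameter e = 5)
    (c1 c2 : V) (c12_central : central_vertices e c1 c2)
    (c1_support : c1 \in strong_support e :|: weak_support e)
    (c2_not_support : c2 \notin strong_support e :|: weak_support e) :
  vertex_magic G e <->
  (forall v : V, v \in weak_support e -> ~~ e c1 v)
  /\ gcd_exponent G (deg e c2).-1 <> 1.
Proof.
have e_sym : symmetric e by case: T_tree.
have e_irr : irreflexive e by case: T_tree.
have sp := diameter5_spine T_tree T_diameter c12_central.
have sp' := spine_sym T_tree sp.
have c12 := spine_adj sp.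
have c21 : e c2 c1 by rewrite e_sym.
have np1 := spine_nonpendant T_tree sp; have np2 := spine_nonpendant T_tree sp'.
have [u0 c1u0 pu0] := (supportP _ _).1 c1_support.
have pendant_nonadj_c2 u : e c2 u -> ~~ pendant e u.
  by move=> c2u; apply: contra c2_not_support => pu; apply/supportP; exists u.
have deg2 : 0 < (deg e c2).-1.
  have [w c2w wc1] := nonpendant_other c21 np2.
  by have := deg_ge2 c2w c21 wc1; case: (deg e c2) => [|[]].
have sum_c2 (l : V -> G) mu : (forall u, e c2 u -> l u = mu) ->
    (\sum_(u in neighbours e c2) l u = mu + mu *+ (deg e c2).-1)%R.
  move=> lmu; rewrite (eq_bigr (fun=> mu)); last by move=> u; rewrite inE => /lmu.
  by rewrite sumr_const -mulrS prednK // (leq_trans deg2) // leq_pred.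
have weak_pendant v u : v \in weak_support e -> e v u -> pendant e u ->
    [set w in neighbours e v | pendant e w]%SET = [set u]%SET.
  rewrite inE => /cards1P[w def_w] vu pu; rewrite def_w; congr [set _]%SET.
  have : u \in [set w in neighbours e v | pendant e w]%SET by rewrite !inE vu.
  by rewrite def_w finset.in_set1 => /eqP.
split.
  move=> [l [l0 [mu lmu]]].
  have lc1 : l c1 = mu by apply: (magic_support lmu pu0); rewrite e_sym.
  split=> [v wv|]; last first.
    apply/(gcd_exponent_neq1P _ deg2); exists mu; split; first by rewrite -lc1.
    have := lmu c2; rewrite (sum_c2 _ mu) => [|b c2b].
      by move/(canRL (addKr _)); rewrite addNr.
    have [->|bc1] := eqVneq b c1; first exact: lc1.
    have [w bw wc2] := nonpendant_other (etrans (e_sym b c2) c2b) (pendant_nonadj_c2 _ c2b).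
    have pw := spine_pendant T_tree T_diameter sp' c2b bc1 bw wc2.
    by apply: (magic_support lmu pw); rewrite e_sym.
  apply/negP => c1v.
  have /supportP[u vu pu] : v \in strong_support e :|: weak_support e.
    by rewrite inE wv orbT.
  have vc2 : v != c2 by apply: contraNneq c2_not_support => <-; rewrite inE wv orbT.
  have uc1 : u != c1 by apply: contraNneq np1 => <-.
  apply: (l0 u); have := lmu v.
  have -> : neighbours e v = [set c1; u]%SET.
    apply/setP => w; rewrite !inE; apply/idP/orP => [vw|[]/eqP-> //]; last by rewrite e_sym.
    have [_|wc1] := eqVneq w c1; [by left | right].
    rewrite -finset.in_set1 -(weak_pendant v u wv vu pu) !inE vw.
    exact: spine_pendant sp c1v vc2 vw wc1.
  rewrite big_setU1 ?big_set1 /= ?lc1; last by rewrite inE eq_sym.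
  by move/(canRL (addKr _)); rewrite addNr.
move=> [noweak /(gcd_exponent_neq1P _ deg2)[mu [mu0 mun]]].
have [y] := infinite_avoid
  (0%R :: [seq (mu - mu *+ k)%R | k <- iota 0 #|V|.+1]) G_infinite.
rewrite inE negb_or => /andP[/eqP y0 ygen].
pose g u : G := if u == c2 then y else mu.
pose t v : G := (mu - \sum_(u in neighbours e v | ~~ pendant e u) g u)%R.
have [v wv|f [f0 fs]] := @pendant_labels G V e e_sym t G_infinite.
  have /supportP[u vu pu] : v \in strong_support e :|: weak_support e.
    by rewrite inE wv orbT.
  have npv : ~~ pendant e v.
    by apply: (spine_pendant_neighbour T_tree T_diameter sp pu); rewrite e_sym.
  have vc2 : e v c2.
    have [->//|vE|[c1v|c2v]|[a [_ _ pv]]] := spine_cover T_tree T_diameter v sp.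
    - by move: c2_not_support; rewrite -vE inE wv orbT.
    - by have := noweak v wv; rewrite c1v.
    - by rewrite e_sym.
    - by rewrite pv in npv.
  rewrite /t (bigD1 c2) /=; last by rewrite inE vc2 np2.
  rewrite (eq_bigr (fun=> mu)); last by move=> w /andP[_ /negbTE wc2]; rewrite /g wc2.
  rewrite sumr_const {1}/g eqxx => t0; case/negP: ygen; apply/mapP.
  exists #|[pred w | (w \in neighbours e v) && ~~ pendant e w && (w != c2)]|.
    by rewrite mem_iota /= ltnS max_card.
  by move/eqP: t0; rewrite subr_eq0 => /eqP {1}->; rewrite addrK.
exists (fun u => if pendant e u then f u else g u); split.
  by move=> u; case: ifP => // _; rewrite /g; case: ifP.
exists mu => v; have [sv|nsv] := boolP (v \in strong_support e :|: weak_support e).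
  rewrite (bigID (pendant e)) /=.
  rewrite (eq_bigr f); last by move=> u /andP[_ ->].
  rewrite fs // [X in (_ + X)%R](eq_bigr g); last by move=> u /andP[_ /negbTE->].
  by rewrite /t subrK.
have no_pendant u : e v u -> ~~ pendant e u.
  by move=> vu; apply: contra nsv => pu; apply/supportP; exists u.
have [pv|npv] := boolP (pendant e v).
  have /cards1P[w Nv] := pv.
  have vw : e v w by have := set11 w; rewrite -Nv inE.
  rewrite Nv big_set1 (negbTE (no_pendant w vw)) /g ifN //.
  by apply: contraTneq pv => wc2; apply: pendant_nonadj_c2; rewrite -wc2 e_sym.
have -> : v = c2.
  have [vE|//|[c1v|c2v]|[a [_ _ pv]]] := spine_cover T_tree T_diameter v sp.
  - by rewrite vE c1_support in nsv.
  - apply/eqP; apply: contraNT nsv => vc2.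
    have [w vw wc1] := nonpendant_other (etrans (e_sym v c1) c1v) npv.
    by apply/supportP; exists w => //; apply: spine_pendant sp c1v vc2 vw wc1.
  - have [vc1|vc1] := eqVneq v c1; first by rewrite vc1 c1_support in nsv.
    have [w vw wc2] := nonpendant_other (etrans (e_sym v c2) c2v) npv.
    have := no_pendant w vw.
    by rewrite (spine_pendant T_tree T_diameter sp' c2v vc1 vw wc2).
  - by rewrite pv in npv.
rewrite (sum_c2 _ mu) ?mun ?addr0 // => u c2u.
rewrite (negbTE (pendant_nonadj_c2 u c2u)) /g ifN //.
by apply: contraTneq c2u => ->; rewrite e_irr.
Qed.
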